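(* Let $T$ be a tree with $n$ vertices $v_1,\dots,v_n$, let $L(T)$ be its Laplacian matrix (rows and columns indexed in the order $v_1,\dots,v_n$), and let $P=P(T)$ be the $n\times n$ matrix whose $(i,j)$-entry is $1$ if $v_i$ lies on the unique path from $v_j$ to $v_n$, and $0$ otherwise. Then $$P\,L(T)\,P^{t}=\operatorname{diag}(1,1,\dots,1,0).$$
   Context: The Laplacian matrix of a graph $G$ is $L(G)=\deg(G)-A(G)$, with $A(G)$ the adjacency matrix and $\deg(G)$ the diagonal matrix of vertex degrees. The path from $v_j$ to $v_n$ includes both endpoints (and for $j=n$ it is the single vertex $v_n$). $P^t$ is the transpose of $P$. The matrix $\operatorname{diag}(1,\dots,1,0)$ is $n\times n$ with exactly one zero on the diagonal, in the last position. *)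

(* Defs.v *)
From mathcomp Require Import all_boot all_order all_algebra.

Set Implicit Arguments.
Unset Strict Implicit.
Unset Printing Implicit Defensive.

Import GRing.Theory.
Local Open Scope ring_scope.

Section Graph.
Variables (V : finType) (e : rel V).

Definition simple_graph : Prop := symmetric e /\ irreflexive e.

Definition connected_graph : Prop := forall x y : V, connect e x y.

(* The bound on the size excludes the degenerate cycles [:: x; y] that the
   symmetry of e turns into closed walks. *)
Definition acyclic_graph : Prop :=
  forall c : seq V, (2 < size c)%N -> ~ ucycle e c.

Definition is_tree : Prop :=
  [/\ (0 < #|V|)%N, simple_graph, connected_graph & acyclic_graph].

(* As in path.v, the vertex sequence of the path is x :: p. *)
Definition is_upath (x y : V) (p : seq V) : bool :=
  [&& path e x p, last x p == y & uniq (x :: p)].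

(* A path repeats no vertex, so quantifying over sequences of length at most
   #|V| loses nothing (on_pathP). In a tree the path from x to y is unique. *)
Definition on_path (x y z : V) : bool :=
  [exists p : #|V|.-bseq V, is_upath x y p && (z \in x :: p)].

Lemma on_pathP (x y z : V) :
  reflect (exists2 p : seq V, is_upath x y p & z \in x :: p) (on_path x y z).
Proof.
apply: (iffP existsP) => [[p /andP[xpy zp]]|[p xpy zp]]; first by exists p.
have sp : (size p <= #|V|)%N.
  have /and3P[_ _ /card_uniqP sz] := xpy.
  by apply: leq_trans (max_card (mem (x :: p))); rewrite sz /=.
by exists (Bseq sp); rewrite xpy.
Qed.

End Graph.

Section Matrices.
Variable R : comNzRingType.

Definition adjacency_mx n (e : rel 'I_n) : 'M[R]_n :=
  \matrix_(i, j) (e i j)%:R.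

Definition degree_mx n (e : rel 'I_n) : 'M[R]_n :=
  diag_mx (\row_i #|[set j | e i j]|%:R).

Definition laplacian_mx n (e : rel 'I_n) : 'M[R]_n :=
  degree_mx e - adjacency_mx e.

Definition path_mx n (e : rel 'I_n.+1) : 'M[R]_n.+1 :=
  \matrix_(i, j) (on_path e j ord_max i)%:R.

End Matrices.

Arguments adjacency_mx R {n} e.
Arguments degree_mx R {n} e.
Arguments laplacian_mx R {n} e.
Arguments path_mx R {n} e.

(* Main.v *)
Require Import Defs.
From mathcomp Require Import all_boot all_order all_algebra.

Set Implicit Arguments.
Unset Strict Implicit.
Unset Printing Implicit Defensive.

Import GRing.Theory.
Local Open Scope ring_scope.

(** Root the tree at the last vertex r, and let B be the oriented incidence
    matrix of the edges: the column of a vertex i other than r stands for the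
    edge from i to its parent and is the indicator of i minus the indicator of
    the parent, and the column of r is zero.  As for every graph, L = B B^t
    ([laplacian_mxE]).  Moreover the path from i to r is i followed by the path
    from the parent of i, so the i-th column of P minus the column of the parent
    of i is the indicator of i; that is, P B = D := diag(1, ..., 1, 0)
    ([path_mx_incidence]).  Hence P L P^t = (P B)(P B)^t = D D^t = D.

    The combinatorial input is [tree_parentP]: a tree has a parent function, of
    the two ends of every edge exactly one is the parent of the other, and the
    paths to r extend along it.  It rests on the uniqueness of paths
    ([upath_uniq]), which comes from the absence of cycles through
    [upath_neighbour]. *)

(** * Paths towards a root of a tree *)

Section Tree.
Variables (V : finType) (e : rel V).
Hypothesis tree_e : is_tree e.

(** A path from x that reaches a neighbour y of x later than at its first
    step closes up, by the edge from y to x, into a cycle. *)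
Lemma upath_neighbour (x y r : V) p :
  is_upath e x r p -> e x y -> y \in p -> p = y :: behead p.
Proof.
case: tree_e => _ [sym_e _] _ acy /and3P[pth_p _ uniq_p] exy yp.
case/splitPr: yp pth_p uniq_p => -[|z p1] p2 //=.
rewrite cat_path /= => /and3P[exz pth_p1 /andP[ezy _]] uniq_p.
case: (acy (x :: z :: rcons p1 y)); first by rewrite /= size_rcons.
apply/andP; split.
  by rewrite /= exz !rcons_path pth_p1 ezy /= last_rcons sym_e.
have : uniq ((x :: z :: rcons p1 y) ++ p2) by rewrite /= cat_rcons.
by rewrite cat_uniq => /andP[].
Qed.

Lemma upath_cons (x y r : V) p :
  is_upath e x r (y :: p) = [&& e x y, x \notin y :: p & is_upath e y r p].
Proof.
rewrite /is_upath /=; case: (e x y) => //=.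
by case: (x \notin _); rewrite /= ?andbF.
Qed.

(** If the second path from x does not start with the first step y of the
    first one, it avoids y; preceded by the edge from y to x, it is then a
    second path from y, passing through x, unlike the rest of the first path. *)
Lemma upath_uniq (x r : V) p q :
  is_upath e x r p -> is_upath e x r q -> p = q.
Proof.
case: (tree_e) => _ [sym_e irr_e] _ _.
elim: p x q => [|y p IHp] x q.
  case: q => // z q /and3P[_ /eqP/= <- _] /and3P[_ /= /eqP xq /andP[]].
  by rewrite -{1}xq mem_last.
rewrite upath_cons => /and3P[exy xp yp] xq.
have [yq | yq] := boolP (y \in q).
  have qE := upath_neighbour xq exy yq.
  move: xq; rewrite qE upath_cons => /and3P[_ _ yq'].
  by rewrite (IHp _ _ yp yq').
have yxq : is_upath e y r (x :: q).
  rewrite upath_cons sym_e exy xq inE negb_or yq !andbT.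
  by apply: contraTneq exy => ->; rewrite irr_e.
by move: xp; rewrite (IHp _ _ yp yxq) !inE eqxx orbT.
Qed.

Lemma on_upath (x r z : V) p :
  is_upath e x r p -> on_path e x r z = (z \in x :: p).
Proof.
move=> xp; apply/on_pathP/idP => [[q xq]|zp]; last by exists p.
by rewrite (upath_uniq xp xq).
Qed.

Lemma tree_upath (x r : V) : exists p, is_upath e x r p.
Proof.
case: tree_e => _ _ conn _.
have /connectP[p pth_p ->] := conn x r.
by case/shortenP: pth_p => q pth_q uniq_q _; exists q; apply/and3P.
Qed.

(** The identities hold between naturals, so that each of them also
    expresses that the two alternatives on its right exclude each other. *)
Lemma tree_parentP (r : V) : exists par : V -> V,
  (forall x z, x != r ->
     on_path e x r z = (z == x) + on_path e (par x) r z :> nat)%N /\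
  (forall x y,
     e x y = (x != r) && (par x == y) + (y != r) && (par y == x) :> nat)%N.
Proof.
case: (tree_e) => _ [sym_e irr_e] _ _.
have [pth pthP] := fin_all_exists (fun x => tree_upath x r).
pose par x := head x (pth x).
have pthE x y p : is_upath e x r (y :: p) -> x != r /\ par x = y.
  move=> xp; rewrite /par (upath_uniq (pthP x) xp); split=> //.
  case/and3P: xp => _ /eqP<- /andP[+ _]; apply: contraNneq => ->.
  exact: (mem_last y p).
have pth_par x : x != r ->
    [/\ e x (par x), x \notin par x :: pth (par x) &
        pth x = par x :: pth (par x)].
  move: (pthP x) => + xr; rewrite /par.
  case: (pth x) => [/and3P[_ /= xr']|y p /=]; first by rewrite xr' in xr.
  by rewrite upath_cons => /and3P[exy xp yp]; rewrite (upath_uniq (pthP y) yp).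
exists par; split=> [x z xr | x y].
  have [_ xp px] := pth_par x xr.
  rewrite (on_upath z (pthP x)) (on_upath z (pthP (par x))) px.
  by rewrite [z \in x :: _]inE; have [->|] := eqVneq z x; rewrite ?(negPf xp).
have [exy | nexy] := boolP (e x y); last first.
  have no_par u v : ~~ e u v -> (u != r) && (par u == v) = false.
    move=> nuv; apply: contraNF nuv => /andP[ur /eqP<-].
    by case: (pth_par u ur).
  by rewrite !no_par // sym_e.
have both : ~~ [&& (x != r) && (par x == y) & (y != r) && (par y == x)].
  apply/negP => /andP[/andP[xr /eqP pxy] /andP[yr /eqP pyx]].
  have [_ + _] := pth_par x xr; rewrite pxy.
  by have [_ _ ->] := pth_par y yr; rewrite pyx !inE eqxx orbT.
have : (x != r) && (par x == y) || (y != r) && (par y == x).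
  have [yp | yp] := boolP (y \in pth x).
    have := pthP x; rewrite (upath_neighbour (pthP x) exy yp).
    by move=> /pthE[-> ->]; rewrite eqxx.
  suff /pthE[-> ->] : is_upath e y r (x :: pth x) by rewrite eqxx orbT.
  rewrite upath_cons sym_e exy pthP inE negb_or yp !andbT.
  by apply: contraTneq exy => ->; rewrite irr_e.
by move: both; case: (_ && (par x == y)); case: (_ && (par y == x)).
Qed.

End Tree.

(** * The incidence matrix of a rooted tree *)

Section Incidence.
Variables (R : comNzRingType) (n : nat) (e : rel 'I_n.+1).
Variable par : 'I_n.+1 -> 'I_n.+1.

Definition nonroot_mx : 'M[R]_n.+1 :=
  diag_mx (\row_(i < n.+1) (if i == ord_max then 0 else 1)).

Definition parent_mx : 'M[R]_n.+1 :=
  \matrix_(k, i) ((i != ord_max) && (par i == k))%:R.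

Definition incidence_mx : 'M[R]_n.+1 := nonroot_mx - parent_mx.

Lemma mul_mx_nonroot m (A : 'M[R]_(m, n.+1)) i j :
  (A *m nonroot_mx) i j = A i j *+ (j != ord_max).
Proof. by rewrite mul_mx_diag !mxE; case: eqP; rewrite ?mulr0 ?mulr1. Qed.

Lemma tr_nonroot_mx : nonroot_mx^T = nonroot_mx.
Proof. exact: tr_diag_mx. Qed.

Lemma nonroot_mx_idem : nonroot_mx *m nonroot_mx = nonroot_mx.
Proof.
apply/matrixP=> i j; rewrite mul_mx_nonroot !mxE.
by case: (eqVneq i j) => [->|]; case: (j == _); rewrite ?mul0rn ?mulr0n.
Qed.

Lemma parent_mx_nonroot : parent_mx *m nonroot_mx = parent_mx.
Proof.
by apply/matrixP=> i j; rewrite mul_mx_nonroot !mxE; case: (j == _).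
Qed.

(** A vertex has only one parent, so two different rows of the parent matrix
    have disjoint supports, and the square norm of a row counts children. *)
Lemma parent_mx_gram k l :
  (parent_mx *m parent_mx^T) k l = (\sum_i parent_mx k i) *+ (k == l).
Proof.
rewrite mxE -sumrMnl; apply: eq_bigr => i _; rewrite !mxE.
have [->|kl] := eqVneq k l; first by case: (_ && _); rewrite ?mulr0 ?mulr1.
have [->|_] := eqVneq (par i) k; last by rewrite andbF mul0r.
by rewrite (negPf kl) andbF mulr0.
Qed.

Lemma path_mx_incidence :
  (forall x z, x != ord_max -> on_path e x ord_max z
     = (z == x) + on_path e (par x) ord_max z :> nat)%N ->
  path_mx R e *m incidence_mx = nonroot_mx.
Proof.
move=> pathE; apply/matrixP=> j i.
rewrite mulmxBr !(mul_mx_nonroot, mxE).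
have [->|ir] := eqVneq i ord_max.
  rewrite big1 ?subr0 => [|k _]; last by rewrite !mxE eqxx mulr0.
  by case: (j =P _) => // _; rewrite mulr0n.
rewrite (bigD1 (par i)) //= big1 => [|k ki]; last first.
  by rewrite !mxE [par i == k]eq_sym (negPf ki) andbF mulr0.
rewrite !mxE ir eqxx mulr1 addr0 pathE // natrD addrK.
by case: eqVneq => // ->; rewrite (negPf ir).
Qed.

(** Every edge at k contributes 1 to the degree, either as the edge from k to
    its parent, which is there unless k is the root, or as an edge from a child
    of k. *)
Lemma laplacian_mxE :
  (forall x y, e x y
     = (x != ord_max) && (par x == y) + (y != ord_max) && (par y == x) :> nat)%N ->
  laplacian_mx R e = incidence_mx *m incidence_mx^T.
Proof.
move=> edgeE.
have adjE : adjacency_mx R e = parent_mx + parent_mx^T.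
  by apply/matrixP=> k l; rewrite !mxE edgeE natrD addrC.
have degE : degree_mx R e = nonroot_mx + parent_mx *m parent_mx^T.
  apply/matrixP=> k l; rewrite [RHS]mxE parent_mx_gram !mxE -mulrnDl.
  have -> : #|[set j | e k j]|%:R = \sum_j adjacency_mx R e k j.
    rewrite -sum1_card natr_sum big_mkcond /=; apply: eq_bigr => j _.
    by rewrite inE mxE; case: (e k j).
  rewrite adjE; congr (_ *+ _).
  under eq_bigr do rewrite mxE; rewrite big_split addrC /=; congr (_ + _).
  rewrite (bigD1 (par k)) //= big1 => [|j jk].
    by rewrite !mxE eqxx andbT addr0; case: (k == _).
  by rewrite !mxE [par k == j]eq_sym (negPf jk) andbF.
have nonroot_trparent : nonroot_mx *m parent_mx^T = parent_mx^T.
  by rewrite -{1}tr_nonroot_mx -trmx_mul parent_mx_nonroot.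
rewrite /laplacian_mx degE adjE /incidence_mx [(_ - _)^T]linearB /=.
rewrite mulmxBl !mulmxBr tr_nonroot_mx nonroot_mx_idem nonroot_trparent.
by rewrite parent_mx_nonroot opprB addrACA -opprD [parent_mx^T + _]addrC.
Qed.

End Incidence.

Theorem theorem15 (R : comNzRingType) (n : nat) (e : rel 'I_n.+1)
    (tree_e : is_tree e) :
  path_mx R e *m laplacian_mx R e *m (path_mx R e)^T =
  diag_mx (\row_(i < n.+1) (if i == ord_max then 0 else 1)).
Proof.
have [par [pathE edgeE]] := tree_parentP tree_e ord_max.
rewrite (laplacian_mxE _ edgeE) mulmxA -mulmxA -trmx_mul.
by rewrite path_mx_incidence // tr_nonroot_mx nonroot_mx_idem.
Qed.
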